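(* Let $\alpha\in\mathbb{C}$. Then there is a finite subset $F$ of $\mathbb{Z}$ such that $F[\alpha]=\mathbb{Z}[\alpha]$ if and only if $\alpha$ is an algebraic number whose conjugates over $\mathbb{Q}$ are either all of modulus one, or all of modulus greater than one.
   Context: For a set $F\subset\mathbb{C}$ and $\alpha\in\mathbb{C}$, $F[\alpha]:=\left\{\sum_{j=0}^{n}\varepsilon_j\alpha^j \mid (\varepsilon_0,\dots,\varepsilon_n)\in F^{n+1},\ n\in\mathbb{N}\right\}$, where $\mathbb{N}$ is the set of non-negative integers. $\mathbb{Z}[\alpha]$ denotes the ring of all polynomials with integer coefficients evaluated at $\alpha$. *)

(* Defs.v *)
From mathcomp Require Import all_boot all_order all_algebra.
From mathcomp Require Import classical_sets cardinality reals.
From mathcomp Require Import complex.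

Set Implicit Arguments.
Unset Strict Implicit.
Unset Printing Implicit Defensive.

Import Order.TTheory GRing.Theory Num.Theory.
Local Open Scope classical_set_scope.
Local Open Scope ring_scope.

Definition digit_expansions (C : numClosedFieldType) (F : set C) (a : C) : set C :=
  [set x | exists (n : nat) (e : 'I_n.+1 -> C),
    (forall j, F (e j)) /\ x = \sum_(j < n.+1) e j * a ^+ j].

Definition int_adjoin (C : numClosedFieldType) (a : C) : set C :=
  [set x | exists p : {poly int}, x = (map_poly intr p).[a]].

Definition is_minpoly (C : numClosedFieldType) (a : C) (p : {poly rat}) : Prop :=
  [/\ p \is monic, irreducible_poly p & root (map_poly ratr p) a].

(* When [a] is transcendental it has no minimal polynomial, and no [b]
   satisfies this predicate. *)
Definition rat_conjugate (C : numClosedFieldType) (a b : C) : Prop :=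
  exists2 p : {poly rat}, is_minpoly a p & root (map_poly ratr p) b.

(* Main.v *)
(** Suppose that every conjugate [z] of [alpha] satisfies [1 <= |z|], and let
    [P] be an integer multiple of the minimal polynomial.  Modulo [P], every
    integer polynomial [Q] is congruent to [e + 'X * Q1] with [|e| <= |P`_0|],
    where [e] may be taken nonzero and of either sign.  Giving [e] the sign of
    the trace of [Q], the sum of the [Q(z)] over the [d] conjugates, makes the
    sum of the [|Q(z)|^2] change by at most [d |P`_0|^2 - 2 |trace Q|] when
    [Q] is replaced by [Q1].  The moments, that is, the sums over [z] of
    [Q(z) z^-j] for [j < d], are bounded perturbations of the traces met in
    the first [d] divisions, and by the Vandermonde determinant they determine
    the values [Q(z)].  Hence the sum of squares, as long as it is large, drops
    by at least 1 in [d] divisions.  The divisions therefore end in a bounded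
    set of polynomials of degree less than [d], whose own coefficients serve as
    the leading digits.

    Conversely, representing a large integer with bounded digits makes [alpha]
    algebraic, and a conjugate of modulus less than 1 would bound all integers.
    If some conjugate [b] has modulus 1 then [b^-1], its complex conjugate, is
    a root of the minimal polynomial, which is therefore reciprocal: no
    conjugate can have modulus greater than 1. *)
From HB Require Import structures.
Require Import Defs.
From mathcomp Require Import all_boot all_order all_algebra.
From mathcomp Require Import boolp classical_sets cardinality reals.
From mathcomp Require Import complex separable algebraics_fundamentals.
From mathcomp Require Import polyorder ring.

Set Implicit Arguments.
Unset Strict Implicit.
Unset Printing Implicit Defensive.

Import Order.TTheory GRing.Theory Num.Theory.
Local Open Scope classical_set_scope.
Local Open Scope ring_scope.

(** * Sums, matrices and Archimedean fields *)

Lemma sumr_const_seq (V : nmodType) (I : Type) (s : seq I) (x : V) :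
  \sum_(i <- s) x = x *+ size s.
Proof. by rewrite big_const_seq count_predT iter_addr_0. Qed.

Lemma ler_sum_seq (R : numDomainType) (I : eqType) (s : seq I) (F G : I -> R) :
  {in s, forall i, F i <= G i} -> \sum_(i <- s) F i <= \sum_(i <- s) G i.
Proof. by move=> FG; rewrite big_seq [leRHS]big_seq; apply: ler_sum. Qed.

Lemma ler_sum_size (R : numDomainType) (I : eqType) (s : seq I) (F : I -> R)
    (K : R) :
  {in s, forall i, F i <= K} -> \sum_(i <- s) F i <= (size s)%:R * K.
Proof. by move=> /ler_sum_seq; rewrite sumr_const_seq mulr_natl. Qed.

Lemma unitmx_coord_bound (R : numDomainType) n (A : 'M[R]_n) :
  A \in unitmx ->
  exists2 L : R, 0 <= L & forall (u : 'rV_n) (K : R), 0 <= K ->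
    (forall j, `|(u *m A) 0 j| <= K) -> forall i, `|u 0 i| <= L * K.
Proof.
move=> A_unit; pose B := invmx A.
exists (\sum_i \sum_j `|B i j|).
  by apply: sumr_ge0 => i _; apply: sumr_ge0.
move=> u K K_ge0 uA_le j; rewrite -[u](mulmxK A_unit) mxE mulr_suml.
apply: le_trans (ler_norm_sum _ _ _) _; apply: ler_sum => i _.
rewrite normrM mulrC ler_pM//.
by rewrite (bigD1 j)//= lerDl sumr_ge0.
Qed.

Lemma Vandermonde_unitmx (F : fieldType) n (a : 'rV[F]_n) :
  injective (a 0) -> Vandermonde n a \in unitmx.
Proof.
move=> a_inj; rewrite unitmxE unitfE det_Vandermonde.
apply/prodf_neq0 => i _; apply/prodf_neq0 => j ij; rewrite subr_eq0.
by apply: contraTneq ij => /a_inj ->; rewrite ltnn.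
Qed.

Section VandermondeBounds.

Variables (R : numFieldType) (s : seq R).
Hypothesis s_uniq : uniq s.

Let V := Vandermonde (size s) (\row_(i < size s) s`_i).

Let V_unit : V \in unitmx.
Proof.
apply: Vandermonde_unitmx => i j; rewrite !mxE => /eqP.
by rewrite nth_uniq// => /eqP/val_inj.
Qed.

Lemma coef_bound_of_values : exists2 L : R, 0 <= L &
  forall (p : {poly R}) (K : R), 0 <= K -> (size p <= size s)%N ->
    {in s, forall z, `|p.[z]| <= K} -> forall i, `|p`_i| <= L * K.
Proof.
have [L L_ge0 coord_le] := unitmx_coord_bound V_unit.
exists L => // p K K_ge0 size_p values_le i.
have [i_ge|i_lt] := leqP (size s) i.
  by rewrite nth_default ?(leq_trans size_p)// normr0 mulr_ge0.
have := coord_le (poly_rV p) K K_ge0 _ (Ordinal i_lt); rewrite mxE; apply => j.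
suff -> : (poly_rV p *m V) 0 j = p.[s`_j] by rewrite values_le// mem_nth.
by rewrite mxE (horner_coef_wide _ size_p); apply: eq_bigr => k _; rewrite !mxE.
Qed.

Lemma bound_of_power_sums : exists2 L : R, 0 <= L &
  forall (f : R -> R) (K : R), 0 <= K ->
    (forall j, (j < size s)%N -> `|\sum_(z <- s) f z * z ^+ j| <= K) ->
    {in s, forall z, `|f z| <= L * K}.
Proof.
have [|L L_ge0 coord_le] := @unitmx_coord_bound _ _ V^T.
  by rewrite unitmx_tr.
exists L => // f K K_ge0 sums_le z zs.
have index_lt : (index z s < size s)%N by rewrite index_mem.
have := coord_le (\row_i f s`_i) K K_ge0 _ (Ordinal index_lt).
rewrite mxE/= nth_index//; apply=> j.
suff -> : ((\row_i f s`_i) *m V^T) 0 j = \sum_(w <- s) f w * w ^+ j.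
  exact: sums_le.
by rewrite (big_nth 0) big_mkord mxE; apply: eq_bigr => k _; rewrite !mxE.
Qed.

End VandermondeBounds.

Lemma archi_descent (R : archiNumDomainType) (T : Type) (g : T -> T)
    (f : T -> R) (N : R) :
  (forall x, 0 <= f x) -> (forall x, f x <= N \/ f (g x) + 1 <= f x) ->
  forall x, exists n, f (iter n g x) <= N.
Proof.
move=> f_ge0 f_desc x; have := ltW (archi_boundP (f_ge0 x)).
move: (Num.bound (f x)) => m.
elim: m x => [|m IH] x fm; have [fN|fg] := f_desc x.
- by exists 0%N.
- have := lt_le_trans (ltr_wpDl (f_ge0 (g x)) ltr01) (le_trans fg fm).
  by rewrite ltxx.
- by exists 0%N.
- have [|n] := IH (g x); last by rewrite -iterSr; exists n.+1.
  by rewrite -(lerD2r 1) natr1 (le_trans fg).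
Qed.

Lemma complex_archimedean (R : archiRcfType) : Num.archimedean_axiom R[i].
Proof.
move=> x; rewrite normc_def; set r := Num.sqrt _.
exists (Num.bound r); rewrite -(rmorph_nat (real_complex R)) ltcR.
by rewrite archi_boundP// sqrtr_ge0.
Qed.

HB.instance Definition _ (R : archiRcfType) :=
  Num.NumDomain_bounded_isArchimedean.Build R[i] (@complex_archimedean R).

Section SignedDivision.

Variables (b : bool) (q m : int).

Definition signed_divz : int := (-1) ^+ b * (((-1) ^+ b * q - 1) %/ m)%Z.
(* Up to sign the residues are [1, ..., |m|]; a residue 0 would lose the trace
   term in [norm_trace_le]. *)
Definition signed_modz : int := (-1) ^+ b * ((((-1) ^+ b * q - 1) %% m)%Z + 1).

Lemma signed_modzE : signed_modz = q - signed_divz * m.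
Proof.
apply/eqP; rewrite eq_sym subr_eq eq_sym addrC /signed_divz /signed_modz.
by rewrite -mulrA -mulrDr addrA -divz_eq subrK signrMK.
Qed.

Hypothesis m_neq0 : m != 0.

Lemma signed_modz_ge1 : 1 <= (-1) ^+ b * signed_modz.
Proof. by rewrite signrMK lerDr modz_ge0. Qed.

Lemma signed_modz_le : `|signed_modz| <= `|m|.
Proof.
rewrite normrMsign ger0_norm ?lezD1 ?ltz_mod//.
by rewrite addr_ge0// modz_ge0.
Qed.

End SignedDivision.

(** * Univariate polynomials *)

Lemma separable_poly_roots (F : closedFieldType) (p : {poly F}) :
  separable_poly p -> exists rs : seq F,
    [/\ uniq rs, size p = (size rs).+1 & forall z, (z \in rs) = root p z].
Proof.
move=> p_sep; have [rs pE] := closed_field_poly_normal p.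
have lead_neq0 : lead_coef p != 0 by rewrite lead_coef_eq0 separable_poly_neq0.
have p_eqp : p %= \prod_(z <- rs) ('X - z%:P) by rewrite {1}pE eqp_scale.
exists rs; split=> [||z].
- by rewrite -separable_prod_XsubC -(eqp_separable p_eqp).
- by rewrite (eqp_size p_eqp) size_prod_XsubC.
- by rewrite (eqp_root p_eqp) root_prod_XsubC.
Qed.

Lemma irredp_root_dvd (F : fieldType) (L : idomainType) (f : {rmorphism F -> L})
    (p q : {poly F}) (z : L) :
  irreducible_poly p -> root (map_poly f p) z ->
  root (map_poly f q) z = (p %| q).
Proof.
move=> p_irr pz; apply/idP/idP => [qz|/dvdpP[r ->]]; last first.
  by rewrite rmorphM rootM pz orbT.
apply: contraTT qz; rewrite -(irreducible_poly_coprime q p_irr).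
by rewrite -(coprimep_map f) => /coprimep_root; apply.
Qed.

Lemma irredp_separable (F : realFieldType) (p : {poly F}) :
  irreducible_poly p -> separable_poly p.
Proof.
move=> p_irr; have [p_size _] := p_irr; have p_neq0 := irredp_neq0 p_irr.
rewrite unlock (irreducible_poly_coprime _ p_irr) gtNdvdp ?lt_size_deriv//.
by rewrite -size_poly_eq0 size_deriv -lt0n -ltnS prednK// ltnW.
Qed.

Lemma map_poly_ratr_intr (F : numFieldType) (p : {poly int}) :
  map_poly (ratr : rat -> F) (map_poly intr p) = map_poly intr p.
Proof.
by rewrite -map_poly_comp; apply: eq_map_poly => e /=; rewrite rmorph_int.
Qed.

Lemma rat_poly_eqp_int (F : numFieldType) (p : {poly rat}) :
  exists P : {poly int},
    map_poly (ratr : rat -> F) p %= map_poly (intr : int -> F) P.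
Proof.
have [P [k k_neq0 ->]] := rat_poly_scale p; exists P.
rewrite map_polyZ/= map_poly_ratr_intr.
by rewrite eqp_scale// fmorph_eq0 invr_eq0 intr_eq0.
Qed.

Section ReversePolynomial.

Variable F : fieldType.
Implicit Types (p : {poly F}) (z : F).

Definition revp p := \poly_(i < size p) p`_(size p - i.+1).

Lemma horner_revp p z :
  z != 0 -> (revp p).[z] = z ^+ (size p).-1 * p.[z^-1].
Proof.
move=> z_neq0; rewrite horner_poly horner_coef mulr_sumr.
rewrite [RHS](reindex_inj rev_ord_inj)/=; apply: eq_bigr => i _.
rewrite mulrCA; congr (_ * _).
have -> : (size p).-1 = (i + (size p - i.+1))%N.
  by case: (size p) i => [[]//|n] i /=; rewrite subSS subnKC// -ltnS.
by rewrite exprD -mulrA -exprMn divff// expr1n mulr1.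
Qed.

Lemma root_revp p z : z != 0 -> root (revp p) z = root p z^-1.
Proof.
move=> z_neq0; rewrite !rootE horner_revp// mulf_eq0 expf_eq0.
by rewrite (negPf z_neq0) andbF.
Qed.

End ReversePolynomial.

Lemma map_revp (F L : fieldType) (f : {rmorphism F -> L}) (p : {poly F}) :
  map_poly f (revp p) = revp (map_poly f p).
Proof.
apply/polyP => i; rewrite coef_map 2!coef_poly size_map_poly coef_map.
by case: ifP => // _; rewrite raddf0.
Qed.

(** * Integer polynomials of bounded height *)

Section EvalInt.

Variable C : numClosedFieldType.
Implicit Types (p : {poly int}) (z : C).

Definition eval_int z : {poly int} -> C := horner_eval z \o map_poly intr.

HB.instance Definition _ z :=
  GRing.RMorphism.copy (eval_int z) (horner_eval z \o map_poly intr).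

Lemma eval_intE z p : eval_int z p = (map_poly intr p).[z].
Proof. by []. Qed.

Lemma eval_intC z (e : int) : eval_int z e%:P = e%:~R.
Proof. by rewrite eval_intE map_polyC hornerC. Qed.

Lemma eval_intX z : eval_int z 'X = z.
Proof. by rewrite eval_intE map_polyX hornerX. Qed.

Lemma eval_int_sum n p z : (size p <= n)%N ->
  eval_int z p = \sum_(i < n) (p`_i)%:~R * z ^+ i.
Proof.
move=> pn; rewrite eval_intE (@horner_coef_wide _ n).
  by apply: eq_bigr => i _; rewrite coef_map.
by rewrite (leq_trans (size_poly _ _)).
Qed.

Lemma eval_int_conj z p : eval_int z^* p = (eval_int z p)^*.
Proof.
rewrite !eval_intE -horner_map -map_poly_comp; congr (_.[_]).
by apply: eq_map_poly => e /=; rewrite rmorph_int.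
Qed.

Lemma root_ratr_intr p z :
  root (map_poly ratr (map_poly intr p)) z = (eval_int z p == 0).
Proof. by rewrite map_poly_ratr_intr. Qed.

End EvalInt.

Section Heights.

Variable C : numClosedFieldType.
Implicit Types (M : nat) (p Q : {poly int}) (a x : C).

Definition height_le M p : Prop := forall i, `|p`_i| <= M%:Z.

Definition height_rep M a x : Prop :=
  exists2 p, height_le M p & x = eval_int a p.

Definition height_reducing a : Prop :=
  exists M, forall Q, height_rep M a (eval_int a Q).

Lemma height_rep_cons M a x (e : int) :
  `|e| <= M%:Z -> height_rep M a x -> height_rep M a (e%:~R + a * x).
Proof.
move=> eM [p pM ->]; exists (cons_poly e p).
  by case=> [|i]; rewrite coef_cons/=.
by rewrite cons_poly_def rmorphD rmorphM/= eval_intX eval_intC addrC mulrC.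
Qed.

End Heights.

Definition int_ball (M : nat) : set int := [set e : int | `|e| <= M%:Z].

Lemma finite_int_ball M : finite_set (int_ball M).
Proof.
pose shift (n : nat) : int := n%:Z - M%:Z.
apply: (@sub_finite_set _ _ (shift @` `I_(M + M).+1)).
  move=> e; rewrite /int_ball/= ler_norml => /andP[Me eM].
  exists (absz (e + M%:Z)); rewrite /shift.
    by rewrite /= ltnS -lez_nat PoszD abszE ger0_norm ?lerD2r// -lerBlDr sub0r.
  by rewrite abszE ger0_norm ?addrK// -lerBlDr sub0r.
exact/finite_image/finite_II.
Qed.

Lemma finite_int_bounded (F : set int) :
  finite_set F -> exists M, F `<=` int_ball M.
Proof.
move=> /finite_seqP[s ->]; exists (\sum_(e <- s) absz e)%N => e /= es.
by rewrite /int_ball/= -abszE lez_nat (big_rem e)//= leq_addr.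
Qed.

Section DigitExpansions.

Variable C : numClosedFieldType.
Implicit Types (a x : C).

Lemma subset_digit_expansions (D E : set C) a :
  D `<=` E -> digit_expansions D a `<=` digit_expansions E a.
Proof.
by move=> DE x [n [e [eD ->]]]; exists n, e; split=> // j; apply: DE.
Qed.

Lemma height_repP M a x :
  height_rep M a x <-> digit_expansions (intr @` int_ball M) a x.
Proof.
split=> [[p pM ->]|[n [e [eM ->]]]].
  exists (size p), (fun j => (p`_j)%:~R); split=> [j|].
    by exists p`_j => //; apply: pM.
  exact: eval_int_sum.
pose m j : {m : int | int_ball M m & m%:~R = e j} := cid2 (eM j).
exists (\poly_(i < n.+1) s2val (m (inord i))) => [i|].
  by rewrite coef_poly; case: ifP => // _; exact: s2valP (m _).
rewrite (eval_int_sum _ (size_poly _ _)); apply: eq_bigr => j _.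
by rewrite coef_poly ltn_ord inord_val (s2valP' (m j)).
Qed.

Lemma height_reducingP a : height_reducing a <->
  exists F : set int, finite_set F /\
    digit_expansions (intr @` F) a = int_adjoin a.
Proof.
split=> [[M rep_a]|[F [/finite_int_bounded[M FM] FE]]].
  exists (int_ball M); split; first exact: finite_int_ball.
  apply/seteqP; split=> x; first by move=> /height_repP[p _ ->]; exists p.
  by move=> [Q ->]; apply/height_repP/rep_a.
exists M => Q; apply/height_repP.
apply: subset_digit_expansions (image_subset _ FM) _ _.
by rewrite FE; exists Q.
Qed.

End DigitExpansions.

(** * Division with digits of prescribed sign *)

Section DigitDivision.

Variables (C : numClosedFieldType) (P : {poly int}) (rs : seq C).
Hypotheses (rs_uniq : uniq rs) (size_P : size P = (size rs).+1).
Hypothesis rsP : forall z, (z \in rs) = (eval_int z P == 0).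
Hypothesis rs_ge1 : {in rs, forall z, 1 <= `|z|}.
Implicit Types (Q : {poly int}) (z : C).

Local Notation d := ((size rs)%:R : C).
Local Notation A := (`|P`_0|%:~R : C).

Definition trace Q : C := \sum_(z <- rs) eval_int z Q.
Definition sqnorm Q : C := \sum_(z <- rs) `|eval_int z Q| ^+ 2.
Definition digit Q : int := signed_modz (trace Q < 0) Q`_0 P`_0.
Definition digit_quo Q : {poly int} :=
  drop_poly 1 (Q - signed_divz (trace Q < 0) Q`_0 P`_0 *: P).

Let A_ge0 : 0 <= A. Proof. by rewrite ler0z. Qed.
Let dA_ge0 : 0 <= d * A. Proof. exact: mulr_ge0. Qed.

Let root_neq0 z : z \in rs -> z != 0.
Proof. by move=> /rs_ge1 z_ge1; rewrite -normr_gt0 (lt_le_trans ltr01). Qed.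

Let P0_neq0 : P`_0 != 0.
Proof.
apply/eqP => P0_eq0; suff /root_neq0/eqP : 0 \in rs by [].
by rewrite rsP eval_intE horner_coef0 coef_map P0_eq0.
Qed.

Lemma sqnorm_ge0 Q : 0 <= sqnorm Q.
Proof. by apply: sumr_ge0 => z _; rewrite exprn_ge0. Qed.

Lemma sqr_norm_le_sqnorm Q z : z \in rs -> `|eval_int z Q| ^+ 2 <= sqnorm Q.
Proof.
move=> zs; rewrite /sqnorm (big_rem z)//= lerDl.
by apply: sumr_ge0 => w _; rewrite exprn_ge0.
Qed.

Lemma trace_conj Q : (trace Q)^* = trace Q.
Proof.
have rs_conj : perm_eq [seq z^* | z <- rs] rs.
  apply: uniq_perm; rewrite ?map_inj_uniq//; first exact: inv_inj conjCK.
  move=> z; rewrite -[z in LHS]conjCK (mem_map (inv_inj conjCK)) !rsP.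
  by rewrite eval_int_conj conjC_eq0.
rewrite [LHS]rmorph_sum -[RHS](perm_big _ rs_conj)/= big_map.
by apply: eq_bigr => z _; rewrite eval_int_conj.
Qed.

Lemma norm_trace_le Q : `|trace Q| <= (digit Q)%:~R * trace Q.
Proof.
have tr_real : trace Q \is Num.real by apply/CrealP/trace_conj.
have -> : (digit Q)%:~R * trace Q =
    (-1) ^+ (trace Q < 0)%R * (digit Q)%:~R * `|trace Q|.
  by rewrite (real_normrEsign tr_real) mulrACA -expr2 sqrr_sign mul1r.
rewrite ler_peMl// -[(-1) ^+ _](intr_sign C) -rmorphM ler1z.
exact: signed_modz_ge1.
Qed.

Lemma norm_digit_le Q : `|digit Q| <= `|P`_0|.
Proof. exact: signed_modz_le. Qed.

Lemma eval_int_digit z Q : z \in rs ->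
  eval_int z Q = (digit Q)%:~R + z * eval_int z (digit_quo Q).
Proof.
rewrite rsP => /eqP Pz; rewrite /digit_quo; set k := signed_divz _ _ _.
have -> : eval_int z Q = eval_int z (Q - k *: P).
  by rewrite rmorphB -mul_polyC rmorphM/= Pz mulr0 subr0.
rewrite -{1}(poly_take_drop 1 (Q - _)) rmorphD rmorphM/= expr1 eval_intX.
rewrite mulrC -(eval_intC z); congr (eval_int z _ + _); apply/polyP => i.
rewrite coef_take_poly coefC; case: i => [|//].
by rewrite coefB coefZ /digit signed_modzE.
Qed.

Lemma size_iter_digit_quo n Q :
  (size (iter n digit_quo Q) <= maxn (size Q - n) (size rs))%N.
Proof.
have size_quo S : (size (digit_quo S) <= maxn (size S).-1 (size rs))%N.
  rewrite size_drop_poly leq_subLR (leq_trans (size_polyD _ _))// size_polyN.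
  rewrite add1n -maxnSS geq_max !leq_max leqSpred/=.
  by rewrite -size_P size_scale_leq orbT.
elim: n => [|n IH] /=; first by rewrite subn0 leq_maxl.
rewrite (leq_trans (size_quo _))// geq_max leq_maxr andbT leq_max.
move: IH; rewrite leq_max => /orP[] sz; apply/orP; [left|right].
  by rewrite subnS -!subn1 leq_sub2r.
by rewrite (leq_trans (leq_pred _)).
Qed.

Lemma height_rep_iter_digit_quo M n z Q : `|P`_0| <= M%:Z -> z \in rs ->
  height_rep M z (eval_int z (iter n digit_quo Q)) ->
  height_rep M z (eval_int z Q).
Proof.
move=> PM zs; elim: n Q => // n IH Q; rewrite iterSr => /IH rep_quo.
rewrite (eval_int_digit Q zs); apply: height_rep_cons rep_quo.
exact: le_trans (norm_digit_le Q) PM.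
Qed.

Lemma sqnormBC Q (e : int) :
  sqnorm (Q - e%:P) = sqnorm Q - 2 * (e%:~R * trace Q) + d * e%:~R ^+ 2.
Proof.
have -> : 2 * (e%:~R * trace Q) = e%:~R * trace Q + e%:~R * (trace Q)^*.
  by rewrite trace_conj; ring.
have -> : d * e%:~R ^+ 2 = \sum_(z <- rs) e%:~R ^+ 2.
  by rewrite sumr_const_seq mulr_natl.
rewrite rmorph_sum opprD addrA !mulr_sumr -!sumrB -big_split/=.
apply: eq_bigr => z _; rewrite rmorphB/= eval_intC !normCK rmorphB/= rmorph_int.
ring.
Qed.

Lemma sqnorm_digit_quo Q :
  sqnorm (digit_quo Q) + 2 * `|trace Q| <= sqnorm Q + d * A ^+ 2.
Proof.
have : sqnorm (digit_quo Q) <= sqnorm (Q - (digit Q)%:P).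
  apply: ler_sum_seq => z zs.
  rewrite rmorphB/= eval_intC (eval_int_digit Q zs) addrC addKr normrM.
  by rewrite lerXn2r ?nnegrE ?mulr_ge0// ler_peMl// rs_ge1.
rewrite sqnormBC => /le_trans quo_le; rewrite -lerBrDr; apply: quo_le.
rewrite [leLHS]addrAC; apply: lerD; last first.
  by rewrite lerN2 ler_pM2l// norm_trace_le.
rewrite lerD2l ler_wpM2l// -(real_normK (realz _ _)).
by rewrite lerXn2r ?nnegrE// -intr_norm ler_int norm_digit_le.
Qed.

Lemma sqnorm_iter_digit_quo n Q :
  sqnorm (iter n digit_quo Q) +
    2 * \sum_(j < n) `|trace (iter j digit_quo Q)| <=
  sqnorm Q + n%:R * (d * A ^+ 2).
Proof.
elim: n => [|n IH]; first by rewrite big_ord0 mulr0 mul0r.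
have := lerD (sqnorm_digit_quo (iter n digit_quo Q)) IH.
rewrite -subr_ge0 => diff_ge0; rewrite -subr_ge0 big_ord_recr/= mulrSr.
by apply: etrans diff_ge0; congr (_ <= _); ring.
Qed.

(* [Q(z) z^-n] is the value at [z] of the [n]-th quotient plus the [n] digits
   times negative powers of [z]. *)
Lemma norm_moment_le n Q :
  `|\sum_(z <- rs) eval_int z Q * z^-1 ^+ n| <=
  `|trace (iter n digit_quo Q)| + n%:R * (d * A).
Proof.
elim: n Q => [|n IH] Q.
  by rewrite mul0r addr0; under eq_bigr do rewrite expr0 mulr1.
have -> : \sum_(z <- rs) eval_int z Q * z^-1 ^+ n.+1 =
    \sum_(z <- rs) eval_int z (digit_quo Q) * z^-1 ^+ n +
    \sum_(z <- rs) (digit Q)%:~R * z^-1 ^+ n.+1.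
  rewrite -big_split/= big_seq [RHS]big_seq; apply: eq_bigr => z zs.
  by rewrite (eval_int_digit Q zs) exprS; have := root_neq0 zs => z_neq0; field.
apply: le_trans (ler_normD _ _) _.
rewrite iterSr -addn1 natrD mulrDl mul1r addrA lerD//.
apply: le_trans (ler_norm_sum _ _ _) _; apply: ler_sum_size => z zs.
rewrite normrM -[leRHS]mulr1 ler_pM ?normr_ge0//.
  by rewrite -intr_norm ler_int norm_digit_le.
rewrite normrX normfV exprn_ile1 ?invr_ge0//.
by rewrite invf_le1 ?rs_ge1// normr_gt0 root_neq0.
Qed.

Lemma sqnorm_bound_of_traces : exists2 L : C, 0 <= L &
  forall Q (K : C), 0 <= K ->
    (forall j, (j < size rs)%N -> `|trace (iter j digit_quo Q)| <= K) ->
    sqnorm Q <= d * (L * (K + d * (d * A))) ^+ 2.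
Proof.
have [|L L_ge0 moments_le] := @bound_of_power_sums C [seq z^-1 | z <- rs].
  by rewrite map_inj_uniq//; apply: invr_inj.
exists L => // Q K K_ge0 traces_le; set B := K + _.
have B_ge0 : 0 <= B by rewrite addr_ge0// mulr_ge0.
apply: ler_sum_size => z zs.
rewrite lerXn2r ?nnegrE ?mulr_ge0// -[z]invrK.
apply: (moments_le (fun w => eval_int w^-1 Q)) => // [j|]; last exact: map_f.
rewrite size_map big_map => jd; under eq_bigr do rewrite invrK.
apply: le_trans (norm_moment_le j Q) _; rewrite lerD ?traces_le//.
by rewrite ler_wpM2r// ler_nat ltnW.
Qed.

Lemma sqnorm_contracts : exists N : C, forall Q,
  sqnorm Q <= N \/ sqnorm (iter (size rs) digit_quo Q) + 1 <= sqnorm Q.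
Proof.
have [L _ small_traces] := sqnorm_bound_of_traces.
pose K := d * (d * A ^+ 2) + 1.
have K_ge0 : 0 <= K by rewrite addr_ge0// !mulr_ge0// exprn_ge0.
exists (d * (L * (K + d * (d * A))) ^+ 2) => Q.
have [/existsP[j trace_ge]|] :=
    boolP [exists j : 'I_(size rs), K <= `|trace (iter j digit_quo Q)|].
  right; rewrite -(lerD2r (d * (d * A ^+ 2))).
  apply: le_trans (sqnorm_iter_digit_quo (size rs) Q).
  rewrite -addrA lerD2l addrC -/K (le_trans trace_ge)//.
  rewrite (bigD1 j)//= mulrDr mulr_natl mulr2n -addrA lerDl.
  by rewrite addr_ge0// mulr_ge0// sumr_ge0.
rewrite negb_exists => /forallP trace_lt; left; apply: small_traces => // j jd.
have := trace_lt (Ordinal jd); rewrite -real_ltNge ?realE ?K_ge0 ?normr_ge0//.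
exact: ltW.
Qed.

Lemma coef_bound_of_sqnorm : exists2 L : C, 0 <= L &
  forall Q (N : C), (size Q <= size rs)%N -> sqnorm Q <= N ->
    forall i, `|Q`_i|%:~R <= L * sqrtC N.
Proof.
have [L L_ge0 coef_le] := coef_bound_of_values rs_uniq.
exists L => // Q N size_Q Q_le i.
have N_ge0 : 0 <= N := le_trans (sqnorm_ge0 Q) Q_le.
rewrite intr_norm -(coef_map (intr : int -> C)); apply: coef_le.
- by rewrite sqrtC_ge0.
- by rewrite (leq_trans (size_poly _ _)).
- move=> z zs; rewrite -eval_intE -[leLHS]sqrCK//.
  rewrite ler_sqrtC ?nnegrE ?exprn_ge0//.
  exact: le_trans (sqr_norm_le_sqnorm Q zs) Q_le.
Qed.

End DigitDivision.

Lemma height_bound_of_sqnorm (C : archiClosedFieldType) (rs : seq C) (N : C) :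
  uniq rs -> exists m, forall Q : {poly int},
    (size Q <= size rs)%N -> sqnorm rs Q <= N -> height_le m Q.
Proof.
move=> rs_uniq; have [L L_ge0 coef_le] := coef_bound_of_sqnorm rs_uniq.
exists (Num.bound (L * sqrtC N)) => Q size_Q Q_le i.
rewrite -(ler_int C) -pmulrn (le_trans (coef_le _ _ size_Q Q_le i))//.
rewrite ltW// archi_boundP// mulr_ge0// sqrtC_ge0.
exact: le_trans (sqnorm_ge0 rs Q) Q_le.
Qed.

Lemma height_reducing_root (C : archiClosedFieldType) (P : {poly int})
    (rs : seq C) :
  uniq rs -> size P = (size rs).+1 ->
  (forall z, (z \in rs) = (eval_int z P == 0)) ->
  {in rs, forall z, 1 <= `|z|} -> {in rs, forall a, height_reducing a}.
Proof.
move=> rs_uniq size_P rsP rs_ge1 a ars; pose T := digit_quo P rs.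
have [N N_contracts] := sqnorm_contracts rs_uniq rsP rs_ge1.
have [m small_height] := height_bound_of_sqnorm N rs_uniq.
exists (addn m (absz P`_0)) => Q.
have [k] := archi_descent (sqnorm_ge0 rs) N_contracts (iter (size Q) T Q).
rewrite -iterM -iterD; set n := (_ + _)%N => nN.
apply: (height_rep_iter_digit_quo rsP rs_ge1 (n := n)) => //.
  by rewrite PoszD abszE lerDr.
exists (iter n T Q) => // i.
rewrite (@le_trans _ _ m%:Z) ?PoszD ?lerDl// small_height//.
apply: leq_trans (size_iter_digit_quo size_P n Q) _.
by rewrite geq_max leqnn andbT leq_subLR /n -addnA addnCA leq_addr.
Qed.

Lemma separable_height_reducing (C : archiClosedFieldType) (P : {poly int})
    (a : C) :
  separable_poly (map_poly (intr : int -> C) P) ->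
  (forall z : C, eval_int z P = 0 -> 1 <= `|z|) ->
  eval_int a P = 0 -> height_reducing a.
Proof.
move=> /separable_poly_roots[rs [rs_uniq size_rs rsP]] P_ge1 Pa.
apply: (height_reducing_root rs_uniq _ rsP); last by rewrite rsP; apply/eqP.
- by rewrite -size_rs size_map_inj_poly//; apply: intr_inj.
- by move=> z; rewrite rsP => /eqP/P_ge1.
Qed.

(** * Conjugates over the rationals *)

Section Conjugates.

Variable C : numClosedFieldType.
Implicit Types (p q : {poly rat}) (a b c : C).

Lemma minpoly_exists a :
  algebraicOver (ratr : rat -> C) a -> exists p, is_minpoly a p.
Proof.
move=> /integral_algebraic a_int.
have [|p [p_monic pa p_irr]] := minPoly_decidable_closure _ a_int.
  by move=> x; apply: pselect.
by exists p.
Qed.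

Lemma is_minpoly_uniq a p q : is_minpoly a p -> is_minpoly a q -> p = q.
Proof.
move=> [p_monic p_irr pa] [q_monic q_irr qa]; apply/eqP.
rewrite -eqp_monic// /eqp -(irredp_root_dvd q p_irr pa) qa.
by rewrite -(irredp_root_dvd p q_irr qa) pa.
Qed.

Lemma rat_conjugateP a b p : is_minpoly a p ->
  rat_conjugate a b <-> root (map_poly ratr p) b.
Proof.
move=> p_min; split=> [[q q_min]|pb]; last by exists p.
by rewrite (is_minpoly_uniq p_min q_min).
Qed.

Lemma rat_conjugate_root a b q : rat_conjugate a b ->
  root (map_poly ratr q) a -> root (map_poly ratr q) b.
Proof.
move=> [p [_ p_irr pa] pb].
by rewrite (irredp_root_dvd q p_irr pa) (irredp_root_dvd q p_irr pb).
Qed.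

Lemma root_ratr_conj q a :
  root (map_poly ratr q) a^* = root (map_poly ratr q) a.
Proof.
rewrite !rootE -(conjC_eq0 (_.[a])) -horner_map -map_poly_comp.
congr (_.[_] == 0); apply: eq_map_poly => x /=; exact/esym/fmorph_rat.
Qed.

Lemma rat_conjugate_inv a b c : c != 0 ->
  rat_conjugate a b -> `|b| = 1 -> rat_conjugate a c -> rat_conjugate a c^-1.
Proof.
move=> c_neq0 [p p_min pb] b_norm1 ac; have [_ p_irr _] := p_min.
have b_neq0 : b != 0 by rewrite -normr_gt0 b_norm1.
apply/(rat_conjugateP _ p_min); rewrite -root_revp// -map_revp.
have pc : root (map_poly ratr p) c by apply/(rat_conjugateP _ p_min).
rewrite (irredp_root_dvd _ p_irr pc) -(irredp_root_dvd _ p_irr pb) map_revp.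
by rewrite root_revp// invC_norm b_norm1 expr1n invr1 mul1r root_ratr_conj.
Qed.

Lemma rat_conjugate_norm_dichotomy a :
  (forall b, rat_conjugate a b -> 1 <= `|b|) ->
  (forall b, rat_conjugate a b -> `|b| = 1) \/
  (forall b, rat_conjugate a b -> 1 < `|b|).
Proof.
move=> conj_ge1.
have [[b ab b_norm1]|no_norm1] :=
  pselect (exists2 b, rat_conjugate a b & `|b| = 1).
  left=> c ac; apply/eqP; rewrite eq_le conj_ge1// andbT.
  have c_gt0 : 0 < `|c| by rewrite (lt_le_trans ltr01)// conj_ge1.
  have c_neq0 : c != 0 by rewrite -normr_gt0.
  have := conj_ge1 _ (rat_conjugate_inv c_neq0 ab b_norm1 ac).
  by rewrite normfV invf_ge1.
right=> c ac; rewrite lt_neqAle conj_ge1// andbT eq_sym.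
by apply/eqP => c_norm1; apply: no_norm1; exists c.
Qed.

End Conjugates.

(** * The height reducing property *)

Lemma algebraic_height_reducing (C : archiClosedFieldType) (a : C) :
  algebraicOver (ratr : rat -> C) a ->
  (forall b, rat_conjugate a b -> 1 <= `|b|) -> height_reducing a.
Proof.
move=> /minpoly_exists[p p_min] conj_ge1; have [_ p_irr pa] := p_min.
have [P pP] := rat_poly_eqp_int C p.
apply: (separable_height_reducing (P := P)).
- by rewrite -(eqp_separable pP) separable_map irredp_separable.
- move=> z /rootP; rewrite -(eqp_root pP) => pz; apply: conj_ge1.
  exact/(rat_conjugateP _ p_min).
- by apply/rootP; rewrite -(eqp_root pP).
Qed.

Section HeightReducingNecessary.

Variable C : numClosedFieldType.
Implicit Types (a b : C).

Lemma height_reducing_conj a b :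
  rat_conjugate a b -> height_reducing a -> height_reducing b.
Proof.
move=> ab [M rep_a]; exists M => Q; have [p pM pQ] := rep_a Q.
exists p => //; apply/eqP; rewrite -subr_eq0 -rmorphB -root_ratr_intr.
by apply: (rat_conjugate_root ab); rewrite root_ratr_intr rmorphB/= pQ subrr.
Qed.

Lemma height_reducing_algebraic a :
  height_reducing a -> algebraicOver (ratr : rat -> C) a.
Proof.
move=> [M /(_ M.+1%:Z%:P)[p pM pE]].
exists (map_poly intr (p - M.+1%:Z%:P)); last first.
  by rewrite root_ratr_intr rmorphB/= pE subrr.
rewrite -size_poly_eq0 size_rat_int_poly size_poly_eq0 subr_eq0.
apply: contraTneq (pM 0) => ->.
by rewrite coefC/= ger0_norm// lez_nat ltnn.
Qed.

Lemma height_le_norm_eval M (p : {poly int}) b :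
  height_le M p -> `|b| < 1 -> `|eval_int b p| * (1 - `|b|) <= M%:R.
Proof.
move=> pM b_lt1; have gap_ge0 : 0 <= 1 - `|b| by rewrite subr_ge0 ltW.
have : `|eval_int b p| <= M%:R * \sum_(i < size p) `|b| ^+ i.
  rewrite (@eval_int_sum _ (size p))//.
  apply: le_trans (ler_norm_sum _ _ _) _; rewrite mulr_sumr.
  apply: ler_sum => i _; rewrite normrM normrX ler_wpM2r ?exprn_ge0//.
  by rewrite -intr_norm pmulrn ler_int.
move=> /(ler_wpM2r gap_ge0)/le_trans; apply.
rewrite -mulrA ler_piMr ?ler0n// mulrC -opprB mulNr -subrX1 opprB.
by rewrite gerBl exprn_ge0.
Qed.

End HeightReducingNecessary.

Lemma height_reducing_norm_ge1 (C : archiClosedFieldType) (b : C) :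
  height_reducing b -> 1 <= `|b|.
Proof.
move=> [M rep_b]; rewrite real_leNgt ?real1 ?normr_real//; apply/negP => b_lt1.
have gap_gt0 : 0 < 1 - `|b| by rewrite subr_gt0.
have quot_ge0 : 0 <= M%:R / (1 - `|b|) by rewrite divr_ge0// ltW.
have [p pM] := rep_b (Num.bound (M%:R / (1 - `|b|)))%:Z%:P.
rewrite eval_intC -pmulrn => pE.
have := height_le_norm_eval pM b_lt1; rewrite -pE normr_nat -ler_pdivlMr//.
by rewrite (lt_geF (archi_boundP quot_ge0)).
Qed.

Theorem mainTheorem1 (R : realType) (alpha : R[i]) :
  (exists F : set int,
     finite_set F /\
     digit_expansions (intr @` F) alpha = int_adjoin alpha)
  <->
  (algebraicOver (ratr : rat -> R[i]) alpha /\
   ((forall beta : R[i], rat_conjugate alpha beta -> `|beta| = 1) \/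
    (forall beta : R[i], rat_conjugate alpha beta -> 1 < `|beta|))).
Proof.
rewrite -height_reducingP; split=> [red|[alg norms]].
  split; first exact: height_reducing_algebraic.
  apply: rat_conjugate_norm_dichotomy => beta conj_beta.
  exact: height_reducing_norm_ge1 (height_reducing_conj conj_beta red).
apply: algebraic_height_reducing alg _ => beta conj_beta.
by case: norms => /(_ _ conj_beta) => [->|/ltW].
Qed.
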